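(* Let $r\ge 4$ be an integer. If a Hadamard matrix of order $2r$ exists, then the $(2r-2)$-dimensional homology $H_{2r-2}(\mathcal{VR}(\mathcal{L}^n_\ell;r);\mathbb{Z})$ is non-trivial for all integers $n,\ell$ satisfying $\ell\ge r$ and $n\ge \ell+r$.
   Context: $Q_n=\{\pm1\}^n$ is equipped with the Hamming distance $d$, where $d(x,y)$ is the number of coordinates in which $x$ and $y$ differ. For $x\in Q_n$, $w(x)$ is the number of coordinates of $x$ equal to $1$, and $\mathcal{L}^n_\ell=\{x\in Q_n: w(x)=\ell\}$, with the restricted Hamming metric. For a metric space $(X,\rho)$ and $r\ge0$, the Vietoris--Rips complex $\mathcal{VR}(X;r)$ is the simplicial complex with vertex set $X$ whose simplices are the finite nonempty subsets $\sigma\subseteq X$ with $\rho(x,y)\le r$ for all $x,y\in\sigma$. A Hadamard matrix of order $m$ is a matrix $H\in\{\pm1\}^{m\times m}$ satisfying $H^TH=HH^T=mI$. *)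

(* Defs.v *)
From HB Require Import structures.
From mathcomp Require Import all_boot all_order all_algebra.
From mathcomp Require Import boolp.

Set Implicit Arguments.
Unset Strict Implicit.
Unset Printing Implicit Defensive.

Import Order.TTheory GRing.Theory Num.Theory.
Local Open Scope ring_scope.

Record simplicial_complex (T : finType) := SimplicialComplex {
  simplices :> {set {set T}};
  simplices_neq0 : set0 \notin simplices;
  simplices_sub : forall s t : {set T},
    s \in simplices -> t \subset s -> t != set0 -> t \in simplices }.

Section Homology.
Variable T : finType.
Implicit Types (s t : {set T}) (u v : T).

(* The position of v in s when vertices are ordered as in [enum T], the vertex
   order that orients every simplex. *)
Definition vertex_index s v : nat :=
  #|[set u in s | (enum_rank u < enum_rank v)%N]|.

(* The coefficient of t in the oriented boundary of s:
   (-1)^i if t is s without its i-th vertex, and 0 if t is not a facet of s. *)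
Definition incidence s t : int :=
  \sum_(v in s | s :\ v == t) (-1) ^+ vertex_index s v.

Variable K : simplicial_complex T.

Definition simplex (k : nat) : finType :=
  {s : {set T} | (s \in (K : {set {set T}})) && (#|s| == k.+1)}.

Definition chain (k : nat) : zmodType := {ffun simplex k -> int}.

(* For k = 0 the codomain is [chain 0] and all the incidence numbers involved
   vanish, so that boundary 0 is the zero map, as in unreduced homology. *)
Definition boundary (k : nat) (c : chain k) : chain k.-1 :=
  [ffun t : simplex k.-1 =>
    \sum_(s : simplex k) c s * incidence (val s) (val t)].

Lemma boundary_is_zmod_morphism k : zmod_morphism (@boundary k).
Proof.
move=> a b; apply/ffunP=> t; rewrite !ffunE -sumrB.
by apply: eq_bigr => s _; rewrite !ffunE mulrBl.
Qed.

HB.instance Definition _ k :=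
  GRing.isZmodMorphism.Build (chain k) (chain k.-1) (@boundary k)
    (@boundary_is_zmod_morphism k).

Lemma incidence_eq0 s t : #|s| != #|t|.+1 -> incidence s t = 0.
Proof.
move=> st; rewrite /incidence big_pred0 // => v; apply/negP => /andP[vs /eqP e].
by case/negP: st; rewrite (cardsD1 v s) vs e add1n.
Qed.

Lemma boundary0 (c : chain 0) : boundary c = 0.
Proof.
apply/ffunP=> t; rewrite !ffunE big1 // => s _.
rewrite incidence_eq0 ?mulr0 //.
by have /andP[_ /eqP->] := valP s; have /andP[_ /eqP->] := valP t.
Qed.

Lemma vertex_indexD1 s u v : u \in s -> u != v ->
  vertex_index s v = ((enum_rank u < enum_rank v)%N + vertex_index (s :\ u) v)%N.
Proof.
move=> us uv; rewrite /vertex_index (cardsD1 u) !inE us; congr addn.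
by apply: eq_card => w; rewrite !inE andbA.
Qed.

Lemma sum_incidence2 s t :
  \sum_(m : {set T}) incidence s m * incidence m t = 0.
Proof.
pose g v u : int := (-1) ^+ vertex_index s v * (-1) ^+ vertex_index (s :\ v) u.
pose P v u := [&& v \in s, u \in s :\ v & s :\ v :\ u == t].
have -> : \sum_(m : {set T}) incidence s m * incidence m t
        = \sum_v \sum_(u | P v u) g v u.
  under eq_bigr do rewrite /incidence big_distrl /=.
  rewrite (exchange_big_dep (fun v => v \in s)) /=; last by move=> m v _ /andP[].
  rewrite big_mkcond /=; apply: eq_bigr => v _; case: ifP => vs; last first.
    by rewrite big_pred0 // => u; rewrite /P vs.
  rewrite (big_pred1 (s :\ v)) => [|m]; last by rewrite /= vs eq_sym.
  by rewrite big_distrr /=; apply: eq_bigl => u; rewrite /P vs.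
set S := LHS.
have anti : S = - S.
  rewrite {1}/S (exchange_big_dep xpredT) //= /S -sumrN.
  apply: eq_bigr => v _; rewrite -sumrN; apply: eq_big => [u|u].
    rewrite /P !inE (eq_sym v u) !setDDl setUC /=.
    by case: (v \in s); case: (u \in s); case: (u == v).
  case/and3P; rewrite !inE => us /andP[vu vs] _; rewrite /g -!exprD.
  have uv : u != v by rewrite eq_sym.
  rewrite (vertex_indexD1 us uv) (vertex_indexD1 vs vu).
  have : enum_rank u != enum_rank v by rewrite (inj_eq enum_rank_inj).
  rewrite neq_ltn.
  case: ltngtP => //= _ _; rewrite ?add0n ?add1n ?addSn ?exprS ?mulN1r ?opprK.
    by rewrite addnC.
  by rewrite addnC.
by apply/eqP; move/eqP: anti; rewrite -addr_eq0 -mulr2n mulrn_eq0.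
Qed.

Lemma boundary_boundary k (c : chain k.+1) : boundary (boundary c) = 0.
Proof.
case: k c => [|k] c; first exact: boundary0.
apply/ffunP=> t; rewrite !ffunE.
under eq_bigr do rewrite ffunE big_distrl /=.
rewrite exchange_big big1 //= => s _.
under eq_bigr do rewrite -mulrA.
rewrite -mulr_sumr; apply/eqP; rewrite mulf_eq0; apply/orP; right; apply/eqP.
rewrite -[RHS](sum_incidence2 (val s) (val t)).
pose Q (m : {set T}) := (m \in (K : {set {set T}})) && (#|m| == k.+2).
rewrite [RHS](bigID Q) /= [X in _ + X]big1 ?addr0; last first.
  move=> m; have /andP[sK /eqP cs] := valP s; have /andP[_ /eqP ct] := valP t.
  have [cm|cm] := eqVneq #|m| k.+2; last first.
    by move=> _; rewrite incidence_eq0 ?mul0r // cs eqSS eq_sym.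
  rewrite /Q cm eqxx andbT => mK; rewrite /incidence [X in X * _]big_pred0 ?mul0r //.
  move=> v; apply/negP => /andP[vs /eqP e]; case/negP: mK.
  by apply: simplices_sub sK _ _; rewrite -?card_gt0 ?cm // -e subsetDl.
by rewrite (big_sub _ (fun m => incidence (val s) m * incidence m (val t))).
Qed.

Definition is_cycle k : {pred chain k} := [pred c | boundary c == 0].
Arguments is_cycle k : clear implicits.

Lemma is_cycle_zmod_closed k : zmod_closed (is_cycle k).
Proof.
split=> [|a b]; rewrite !inE ?raddf0 //.
by move=> /eqP ea /eqP eb; rewrite raddfB /= ea eb subr0.
Qed.

HB.instance Definition _ k :=
  GRing.isZmodClosed.Build (chain k) (is_cycle k) (@is_cycle_zmod_closed k).

Record cycles k := Cycles { cycle_val :> chain k; _ : cycle_val \in is_cycle k }.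

HB.instance Definition _ k := [isSub for @cycle_val k].
HB.instance Definition _ k := [Choice of cycles k by <:].
HB.instance Definition _ k := [SubChoice_isSubZmodule of cycles k by <:].

(* Boundaries, as elements of the group of cycles; by [boundary_boundary] every
   [boundary b] is the value of some cycle. *)
Definition is_boundary k : {pred cycles k} :=
  [pred z : cycles k | `[< exists b : chain k.+1, boundary b = val z >] ].
Arguments is_boundary k : clear implicits.

Lemma is_boundary_zmod_closed k : zmod_closed (is_boundary k).
Proof.
split=> [|x y]; rewrite !inE; first by apply/asboolP; exists 0; rewrite !raddf0.
move=> /asboolP[a ea] /asboolP[b eb]; apply/asboolP; exists (a - b).
by rewrite !raddfB /= ea eb.
Qed.

HB.instance Definition _ k :=
  GRing.isZmodClosed.Build (cycles k) (is_boundary k)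
    (@is_boundary_zmod_closed k).

Definition homology k : zmodType := Quotient.quot (is_boundary k).

End Homology.

Arguments is_cycle {T} K k.
Arguments is_boundary {T} K k.

Section VietorisRips.
Variables (T : finType) (rho : T -> T -> nat) (r : nat).

Definition vietoris_rips_simplices : {set {set T}} :=
  [set s | (s != set0) && [forall x in s, forall y in s, (rho x y <= r)%N]].

Lemma vietoris_rips_neq0 : set0 \notin vietoris_rips_simplices.
Proof. by rewrite inE eqxx. Qed.

Lemma vietoris_rips_sub (s t : {set T}) : s \in vietoris_rips_simplices ->
  t \subset s -> t != set0 -> t \in vietoris_rips_simplices.
Proof.
rewrite !inE => /andP[_ /forall_inP h] /subsetP ts -> /=.
apply/forall_inP => x xt; apply/forall_inP => y yt.
by have /forall_inP := h x (ts x xt); apply; apply: ts.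
Qed.

Definition vietoris_rips : simplicial_complex T :=
  SimplicialComplex vietoris_rips_neq0 vietoris_rips_sub.

End VietorisRips.

(* The hypercube {1, -1}^n, with true standing for 1 and false for -1. *)
Definition cube (n : nat) : finType := {ffun 'I_n -> bool}.

Definition hamming n (x y : cube n) : nat := #|[set i | x i != y i]|.

Definition weight n (x : cube n) : nat := #|[set i | x i]|.

Definition layer (n l : nat) : finType := {x : cube n | weight x == l}.

Definition layer_dist n l (x y : layer n l) : nat := hamming (val x) (val y).

Definition hadamard m (H : 'M[int]_m) : Prop :=
  [/\ forall i j, H i j = 1 \/ H i j = -1,
      H^T *m H = m%:R%:M & H *m H^T = m%:R%:M].

(* Main.v *)
Require Import Defs.
From mathcomp Require Import all_boot all_order all_algebra.
From mathcomp Require Import boolp zify ring.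
Import Order.TTheory GRing.Theory Num.Theory.

Set Implicit Arguments.
Unset Strict Implicit.
Unset Printing Implicit Defensive.

Local Open Scope ring_scope.
Local Open Scope quotient_scope.

(** Changing the signs of rows and columns, assume that the first row and the
first column of the Hadamard matrix of order 2r are constantly 1.  The other
2r - 1 rows are orthogonal to the first one, hence have weight r; together with
their opposites, and padded with a fixed tail of weight l - r, they are points
of the layer.  Orthogonal sign vectors of length 2r are at distance r and
opposite ones at distance 2r > r, so these points span the boundary of a
cross-polytope, a simplicial (2r - 2)-sphere, in the Vietoris-Rips complex.

The fundamental cycle of this sphere cannot be a boundary because it has a
non-zero coefficient at a maximal simplex of the whole complex, namely the
facet made of the 2r - 1 rows themselves, which all start with a 1
([positive_orthant_row]).  Indeed let (y, z) be a point of the layer at distance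
at most r from all of them, let k be the distance of z to the fixed tail, and
let a_i be the inner product of y with the i-th row.  Then a_i >= 2k for i > 0,
and a_0 >= - 2k by the weight condition.  The sum of the a_i is 2r y_0 <= 2r,
because the first column is orthogonal to the others; as r > 2, this forces
k = 0.  Now all the a_i lie between 0 and 2r, their sum is at most 2r and the
sum of their squares is 4r^2 by Parseval, so some a_i is 2r, that is, y is a
row; it is not the first row, whose weight is wrong.

The homological half is [cross_polytope_homology], valid for any complex.  The
fundamental cycle is built by repeated suspension: each new pair of opposite
vertices contributes the difference of two cones, and the boundary of a cone
over a cycle is that cycle ([set_boundary_cone]). *)

(** * Cones over integer-valued functions on finite sets *)

Section SetFunctions.
Variable T : finType.
Implicit Types (s t : {set T}) (u v : T) (f : {set T} -> int).

(** Counting the elements of [t] before [u], this makes sense whether or not [u]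
belongs to [t]; it is the incidence of [t] in [u |: t] in the latter case. *)
Definition insertion_sign t u : int := (-1) ^+ vertex_index t u.

(** The augmented boundary on the full simplex over [T]: here the empty set is a
(-1)-simplex, so that suspending the empty set yields a pair of points and the
construction of spheres is uniform in the dimension. *)
Definition set_boundary f t : int := \sum_(s : {set T}) f s * incidence s t.

Definition cone v f s : int :=
  if v \in s then insertion_sign s v * f (s :\ v) else 0.

Lemma insertion_signK t u : insertion_sign t u * insertion_sign t u = 1.
Proof. by rewrite -expr2 sqrr_sign. Qed.

Lemma insertion_signU1 t u : insertion_sign (u |: t) u = insertion_sign t u.
Proof.
congr (_ ^+ _); apply: eq_card => w; rewrite !inE.
by have [->|] := eqVneq w u; rewrite //= ltnn andbF.
Qed.

(** Removing [u] and [v] in the two possible orders gives opposite signs: the one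
of the two that comes first shifts the position of the other. *)
Lemma insertion_sign_swap t u v : v \in t -> u \notin t ->
  insertion_sign t u * insertion_sign (u |: t) v =
  - (insertion_sign t v * insertion_sign (t :\ v) u).
Proof.
move=> vt ut; have uv : u != v by apply: contraNneq ut => ->.
rewrite /insertion_sign -!exprD.
rewrite (@vertex_indexD1 _ t v u) // 1?eq_sym //.
rewrite (@vertex_indexD1 _ (u |: t) u v) ?setU11 // setU1K //.
have : enum_rank u != enum_rank v by rewrite (inj_eq enum_rank_inj).
rewrite neq_ltn; case: ltngtP => //= _ _.
  by rewrite add0n add1n addnS exprS mulN1r addnC.
by rewrite add0n add1n addSn exprS mulN1r addnC.
Qed.

Lemma set_boundaryE f t :
  set_boundary f t = \sum_(u | u \notin t) insertion_sign t u * f (u |: t).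
Proof.
rewrite /set_boundary; under eq_bigr do rewrite /incidence big_distrr /=.
rewrite (exchange_big_dep xpredT) //= [RHS]big_mkcond /=.
apply: eq_bigr => u _; case: ifP => [ut|/negbFE ut]; last first.
  rewrite big_pred0 // => s; apply/negP => /andP[us /eqP e].
  by move: ut; rewrite -e setD11.
rewrite (big_pred1 (u |: t)) => [|s] /=.
  by rewrite mulrC -/(insertion_sign _ _) insertion_signU1.
apply/andP/eqP => [[us /eqP <-]|->]; first by rewrite setD1K.
by rewrite setU11 setU1K.
Qed.

(** The cone is a contracting homotopy: the facet opposite to the apex gives back
[f], and the other facets form, by [insertion_sign_swap], the cone over the
boundary. *)
Lemma set_boundary_cone v f : (forall s, v \in s -> f s = 0) ->
  forall t, set_boundary (cone v f) t = f t - cone v (set_boundary f) t.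
Proof.
move=> f0 t; rewrite set_boundaryE /cone; case: ifP => vt; last first.
  rewrite (bigD1 v) ?vt //= setU11 insertion_signU1 setU1K ?vt //.
  rewrite mulrA insertion_signK mul1r subr0 big1 ?addr0 // => u /andP[_ uv].
  by rewrite in_setU1 vt orbF eq_sym (negbTE uv) mulr0.
rewrite set_boundaryE f0 // sub0r mulr_sumr -sumrN.
rewrite [RHS](bigD1 v) ?setD11 //= setD1K // f0 // !mulr0 oppr0 add0r.
apply: eq_big => u.
  rewrite !inE negb_and negbK.
  by case: eqVneq => [->|]; rewrite ?vt ?andbF ?andbT.
move=> ut; rewrite in_setU1 vt orbT mulrA insertion_sign_swap // mulNr mulrA.
have uv : u != v by apply: contraNneq ut => ->.
congr (- (_ * f _)); apply/setP => w; rewrite !inE.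
by have [->|//] := eqVneq w v; rewrite eq_sym (negbTE uv).
Qed.

Lemma set_boundaryB f g t :
  set_boundary (fun s => f s - g s) t = set_boundary f t - set_boundary g t.
Proof.
by rewrite /set_boundary -sumrB; apply: eq_bigr => s _; rewrite mulrBl.
Qed.

(** * The fundamental cycle of a cross-polytope *)

Section CrossPolytope.
Variables (I : finType) (p : I -> bool -> T).
Hypothesis p_inj : forall i j b c, p i b = p j c -> i = j /\ b = c.

Definition facet (S : seq I) (e : I -> bool) : {set T} :=
  [set p i (e i) | i in S].

Lemma facet_cons i S e : facet (i :: S) e = p i (e i) |: facet S e.
Proof.
apply/setP => x; rewrite in_setU1; apply/imsetP/orP.
  by case=> j; rewrite inE => /orP[/eqP->|jS] ->; [left|right; apply: imset_f].
case=> [/eqP->|/imsetP[j jS ->]]; first by exists i; rewrite ?mem_head.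
by exists j; rewrite // inE jS orbT.
Qed.

Lemma notin_facet i b S e : i \notin S -> p i b \notin facet S e.
Proof. by apply: contra => /imsetP[j jS /p_inj[->]]. Qed.

(** The iterated suspension with poles [p i true] and [p i false], for [i] in
[S]. *)
Fixpoint cross_cycle (S : seq I) : {set T} -> int :=
  if S is i :: S' then
    fun s => cone (p i true) (cross_cycle S') s
             - cone (p i false) (cross_cycle S') s
  else fun s => (s == set0)%:R.

Lemma cross_cycle_support S s :
  uniq S -> cross_cycle S s != 0 -> exists e, s = facet S e.
Proof.
elim: S s => [|i S IH] s /=.
  have [->|] := eqVneq s set0; rewrite ?eqxx // => _ _; exists xpredT.
  by apply/setP => x; rewrite inE; apply/esym/imsetP => -[].
move=> /andP[iS uS].
suff cone_support b : cone (p i b) (cross_cycle S) s != 0 ->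
    exists e, s = facet (i :: S) e.
  have [->|/cone_support //] := eqVneq (cone (p i true) (cross_cycle S) s) 0.
  by rewrite sub0r oppr_eq0 => /cone_support.
rewrite /cone; case: ifP => // ps; rewrite mulf_eq0 negb_or => /andP[_ /IH].
case=> // e sE; exists (fun j => if j == i then b else e j).
rewrite facet_cons eqxx -[LHS](setD1K ps) sE; congr (_ |: _).
by apply: eq_in_imset => j jS; case: eqVneq => // ji; rewrite -ji jS in iS.
Qed.

Lemma cross_cycle_avoid i b S s :
  uniq S -> i \notin S -> p i b \in s -> cross_cycle S s = 0.
Proof.
move=> uS iS; apply: contraTeq => /cross_cycle_support[] // e ->.
exact: notin_facet.
Qed.

(** Both cones over a cycle have this cycle as boundary, so their difference is a
cycle again. *)
Lemma set_boundary_cross_cycle S t :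
  uniq S -> set_boundary (cross_cycle S) t = 0.
Proof.
elim: S t => [|i S IH] t /=.
  move=> _; rewrite /set_boundary (bigD1 set0) //= big1 ?addr0 => [|s /negbTE->].
    by rewrite /incidence big_pred0 ?mulr0 // => v; rewrite inE.
  by rewrite mul0r.
move=> /andP[iS uS]; rewrite set_boundaryB.
have z0 b s : p i b \in s -> cross_cycle S s = 0 by apply: cross_cycle_avoid.
rewrite !set_boundary_cone; try exact: z0.
by rewrite /cone !IH // !mulr0 !if_same !subr0 subrr.
Qed.

(** Each suspension step passes the coefficient of the previous facet on, up to
sign, since only one of the two cones meets the new facet. *)
Lemma cross_cycle_facet S :
  uniq S -> cross_cycle S (facet S xpredT) != 0.
Proof.
elim: S => [|i S IH] /=.
  rewrite (_ : facet _ _ = set0) ?eqxx //.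
  by apply/setP => x; rewrite inE; apply/imsetP => -[].
move=> /andP[iS uS]; rewrite facet_cons /cone setU11 in_setU1.
rewrite (negbTE (notin_facet _ _ iS)) orbF.
rewrite (_ : (p i false == _) = false); last by apply/eqP => /p_inj[].
rewrite subr0 mulf_neq0 ?setU1K ?IH ?notin_facet //.
by rewrite /insertion_sign signr_eq0.
Qed.

(** A maximal simplex is not a facet of any simplex, so every boundary vanishes
there; the fundamental cycle does not. *)
Lemma cross_polytope_homology (K : simplicial_complex T) k :
    #|I| = k.+1 ->
    (forall e : I -> bool, [set p i (e i) | i : I] \in simplices K) ->
    (forall v, v \notin [set p i true | i : I] ->
       v |: [set p i true | i : I] \notin simplices K) ->
  exists h : homology K k, h != 0.
Proof.
move=> cI facetK maxK; pose z := cross_cycle (enum I).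
have facet_enum e : facet (enum I) e = [set p i (e i) | i : I].
  by apply/setP => x; apply/imsetP/imsetP => -[i _ ->]; exists i; rewrite ?mem_enum.
have uI := enum_uniq I.
have z_simplex s : z s != 0 -> (s \in simplices K) && (#|s| == k.+1).
  move=> /(cross_cycle_support uI)[e ->]; rewrite facet_enum facetK.
  by rewrite card_imset ?cI ?eqxx // => i j /p_inj[].
have z0 : z (facet (enum I) xpredT) != 0 by apply: cross_cycle_facet.
pose c : chain K k := [ffun s : simplex K k => z (val s)].
have c_cycle : c \in is_cycle K k.
  rewrite inE; apply/eqP/ffunP => t; rewrite !ffunE.
  rewrite -[RHS](set_boundary_cross_cycle (val t) uI) /set_boundary -/z.
  rewrite [RHS](bigID (fun s => (s \in simplices K) && (#|s| == k.+1))) /=.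
  rewrite [X in _ + X]big1 ?addr0 => [|s]; last first.
    by apply: contraNeq; rewrite mulf_eq0 negb_or => /andP[/z_simplex].
  under eq_bigr do rewrite ffunE.
  by rewrite (big_sub _ (fun s => z s * incidence s (val t))).
pose C := Cycles c_cycle.
exists (\pi_(homology K k) C); apply/eqP => C0.
have : C - 0 \in is_boundary K k.
  by rewrite Quotient.idealrBE; apply/eqP; rewrite C0 !piE.
rewrite subr0 inE => /asboolP[b /= /ffunP bC].
have facet_k := z_simplex _ z0.
have /negP := z0; apply; apply/eqP.
have := bC (exist (fun s => (s \in simplices K) && (#|s| == k.+1)) _ facet_k).
rewrite !ffunE /= => <-.
rewrite big1 // => s _; have /andP[sK _] := valP s.
rewrite /incidence big_pred0 ?mulr0 // => v; apply/negP => /andP[vs /eqP sv].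
have vF : v \notin [set p i true | i : I] by rewrite -facet_enum -sv setD11.
by have /negP := maxK v vF; rewrite -facet_enum -sv setD1K.
Qed.

End CrossPolytope.

End SetFunctions.

(** * Inner products of sign vectors *)

Definition sign_of (b : bool) : int := if b then 1 else -1.

Lemma sign_of_sqr b : sign_of b * sign_of b = 1.
Proof. by case: b. Qed.

Definition inner n (x y : cube n) : int :=
  \sum_i sign_of (x i) * sign_of (y i).

Lemma hammingE n (x y : cube n) : hamming x y = (\sum_i (x i != y i))%N.
Proof. by rewrite /hamming cardsE -sum1_card big_mkcond. Qed.

Lemma weightE n (x : cube n) : weight x = (\sum_i x i)%N.
Proof. by rewrite /weight cardsE -sum1_card big_mkcond. Qed.

Lemma hamming_refl n (x : cube n) : hamming x x = 0%N.
Proof. by rewrite hammingE big1 // => i _; rewrite eqxx. Qed.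

Lemma hamming_eq0 n (x y : cube n) : hamming x y = 0%N -> x = y.
Proof.
move/eqP; rewrite cards_eq0 => /eqP/setP xy; apply/ffunP => i.
by apply/eqP; have := xy i; rewrite !inE => /negbFE.
Qed.

Lemma Posz_sum (I : finType) (F : I -> nat) :
  (\sum_i F i)%N%:Z = \sum_i (F i)%:Z.
Proof. exact: (big_morph Posz PoszD). Qed.

Lemma sum1_ord n : \sum_(i < n) (1 : int) = n%:Z.
Proof. by rewrite sumr_const card_ord natz. Qed.

Lemma inner_hamming n (x y : cube n) : inner x y = n%:Z - 2 * (hamming x y)%:Z.
Proof.
rewrite hammingE Posz_sum mulr_sumr -sum1_ord -sumrB; apply: eq_bigr => i _.
by case: (x i); case: (y i).
Qed.

Lemma inner_ones n (x y : cube n) :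
  (forall i, y i) -> inner x y = 2 * (weight x)%:Z - n%:Z.
Proof.
move=> y1; rewrite weightE Posz_sum mulr_sumr -sum1_ord -sumrB.
apply: eq_bigr => i _.
by rewrite y1; case: (x i).
Qed.

Lemma weight_hamming n (x y : cube n) : (weight x <= weight y + hamming x y)%N.
Proof.
rewrite !weightE hammingE -big_split leq_sum // => i _.
by case: (x i); case: (y i).
Qed.

Definition negate n (x : cube n) : cube n := [ffun i => ~~ x i].

Lemma inner_negate n (x y : cube n) : inner x (negate y) = - inner x y.
Proof.
rewrite -sumrN; apply: eq_bigr => i _; rewrite ffunE.
by case: (x i); case: (y i).
Qed.

Lemma innerC n (x y : cube n) : inner x y = inner y x.
Proof. by apply: eq_bigr => i _; rewrite mulrC. Qed.

(** * Concatenation *)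

Definition concat n q (x : cube n) (y : cube q) : cube (n + q) :=
  [ffun i => match split i with inl j => x j | inr j => y j end].

Lemma concat_lshift n q (x : cube n) (y : cube q) i :
  concat x y (lshift q i) = x i.
Proof. by rewrite ffunE (unsplitK (inl i)). Qed.

Lemma concat_rshift n q (x : cube n) (y : cube q) i :
  concat x y (rshift n i) = y i.
Proof. by rewrite ffunE (unsplitK (inr i)). Qed.

Lemma hamming_concat n q (x x' : cube n) (y y' : cube q) :
  hamming (concat x y) (concat x' y') = (hamming x x' + hamming y y')%N.
Proof.
rewrite !hammingE big_split_ord; congr (_ + _)%N; apply: eq_bigr => i _.
  by rewrite !concat_lshift.
by rewrite !concat_rshift.
Qed.

Lemma weight_concat n q (x : cube n) (y : cube q) :
  weight (concat x y) = (weight x + weight y)%N.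
Proof.
rewrite !weightE big_split_ord; congr (_ + _)%N; apply: eq_bigr => i _.
  by rewrite !concat_lshift.
by rewrite !concat_rshift.
Qed.

Lemma concat_surj n q (x : cube (n + q)) : exists y z, x = concat y z.
Proof.
exists [ffun i => x (lshift q i)], [ffun i => x (rshift n i)].
apply/ffunP => i; rewrite ffunE.
by case: splitP => j ij; rewrite ffunE; congr (x _); apply: val_inj.
Qed.

Lemma exists_weight q w : (w <= q)%N -> exists c : cube q, weight c = w.
Proof.
move=> /subnKC <-; exists (concat [ffun=> true] [ffun=> false]).
rewrite weight_concat !weightE [X in (_ + X)%N]big1 ?addn0 => [|i _];
  last by rewrite ffunE.
by rewrite -[RHS]card_ord -sum1_card; apply: eq_bigr => i _; rewrite ffunE.
Qed.

(** * Normalized Hadamard matrices *)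

Definition normalized_hadamard m (G : 'I_m.+1 -> cube m.+1) : Prop :=
  [/\ forall j, G ord0 j, forall i, G i ord0,
      forall i j, inner (G i) (G j) = if i == j then m.+1%:Z else 0 &
      forall i j, \sum_k sign_of (G k i) * sign_of (G k j) =
        if i == j then m.+1%:Z else 0].

(** Multiply each column by its first entry, then each row by its (new) first
entry. *)
Lemma hadamard_normalize m (H : 'M[int]_m.+1) :
  hadamard H -> exists G : 'I_m.+1 -> cube m.+1, normalized_hadamard G.
Proof.
case=> H1 HtH HHt.
have sq i j : H i j * H i j = 1 by case: (H1 i j) => ->.
pose h i j := H i j * H ord0 j * H i ord0 * H ord0 ord0.
pose G : 'I_m.+1 -> cube m.+1 := fun i => [ffun j => h i j == 1].
have Gh i j : sign_of (G i j) = h i j.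
  rewrite ffunE /h.
  case: (H1 i j) => ->; case: (H1 ord0 j) => ->; case: (H1 i ord0) => ->;
  by case: (H1 ord0 ord0) => ->.
have rows i j : \sum_k H i k * H j k = if i == j then m.+1%:Z else 0.
  have := congr1 (fun A : 'M_m.+1 => A i j) HHt; rewrite !mxE natz => E.
  transitivity (m.+1%:Z *+ (i == j)); last by case: eqP.
  by rewrite -E; apply: eq_bigr => k _; rewrite mxE.
have cols i j : \sum_k H k i * H k j = if i == j then m.+1%:Z else 0.
  have := congr1 (fun A : 'M_m.+1 => A i j) HtH; rewrite !mxE natz => E.
  transitivity (m.+1%:Z *+ (i == j)); last by case: eqP.
  by rewrite -E; apply: eq_bigr => k _; rewrite mxE.
exists G; split=> [j|i|i j|i j].
- by rewrite ffunE /h sq mul1r sq.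
- by rewrite ffunE /h -mulrA mulrACA !sq.
- rewrite /inner; transitivity (H i ord0 * H j ord0 * \sum_k H i k * H j k).
    rewrite mulr_sumr; apply: eq_bigr => k _; rewrite !Gh /h.
    transitivity (H i ord0 * H j ord0 * (H i k * H j k)
      * (H ord0 k * H ord0 k) * (H ord0 ord0 * H ord0 ord0)); first by ring.
    by rewrite !sq !mulr1.
  by rewrite rows; case: eqP => [->|]; rewrite ?sq ?mul1r ?mulr0.
- transitivity (H ord0 i * H ord0 j * \sum_k H k i * H k j).
    rewrite mulr_sumr; apply: eq_bigr => k _; rewrite !Gh /h.
    transitivity (H ord0 i * H ord0 j * (H k i * H k j)
      * (H k ord0 * H k ord0) * (H ord0 ord0 * H ord0 ord0)); first by ring.
    by rewrite !sq !mulr1.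
  by rewrite cols; case: eqP => [->|]; rewrite ?sq ?mul1r ?mulr0.
Qed.

Section Normalized.
Variables (m : nat) (G : 'I_m.+1 -> cube m.+1).
Hypothesis hG : normalized_hadamard G.

(** The rows add up to the order times the first basis vector: every column but
the first is orthogonal to the first one, which is constant. *)
Lemma sum_inner_rows y : \sum_i inner y (G i) = m.+1%:Z * sign_of (y ord0).
Proof.
have [_ G0 _ cols] := hG.
rewrite /inner exchange_big /= (bigD1 ord0) //= -mulr_sumr.
have colsum j : \sum_i sign_of (G i j) = if j == ord0 then m.+1%:Z else 0.
  by rewrite -cols; apply: eq_bigr => i _; rewrite G0 mulr1.
rewrite colsum eqxx big1 ?addr0 => [|j /negbTE j0]; first exact: mulrC.
by rewrite -mulr_sumr colsum j0 mulr0.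
Qed.

Lemma parseval_rows y : \sum_i inner y (G i) ^+ 2 = m.+1%:Z ^+ 2.
Proof.
have [_ _ _ cols] := hG.
transitivity (\sum_j \sum_k sign_of (y j) * sign_of (y k) *
                \sum_i sign_of (G i j) * sign_of (G i k)).
  under [RHS]eq_bigr do under eq_bigr do rewrite mulr_sumr.
  under [RHS]eq_bigr do rewrite exchange_big /=.
  rewrite exchange_big /=; apply: eq_bigr => i _.
  rewrite expr2 /inner mulr_suml; apply: eq_bigr => j _.
  by rewrite mulr_sumr; apply: eq_bigr => k _; ring.
transitivity (\sum_(j < m.+1) m.+1%:Z).
  apply: eq_bigr => j _; rewrite (bigD1 j) //= cols eqxx sign_of_sqr mul1r.
  by rewrite big1 ?addr0 // => k kj; rewrite cols eq_sym (negbTE kj) mulr0.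
by rewrite sumr_const card_ord -mulr_natr natz expr2.
Qed.

(** Sign vectors having non-negative inner products with all rows are rows.  The
slack [k] accounts for points whose tail moves away from the tail of the rows:
such a point has to be closer to every row but the first. *)
Lemma positive_orthant_row (y : cube m.+1) (k : nat) :
  (4 < m.+1)%N -> (forall i, i != ord0 -> 2 * k%:Z <= inner y (G i)) ->
  - (2 * k%:Z) <= inner y (G ord0) -> k = 0%N /\ exists i, y = G i.
Proof.
move=> m4 rows_ge row0_ge.
have sum_le : \sum_i inner y (G i) <= m.+1%:Z.
  by rewrite sum_inner_rows /sign_of; case: (y _); lia.
(* The m bounds 2k and the bound - 2k add up to 2k (m - 1) <= m + 1, which is
   impossible for k > 0 as soon as m > 3. *)
have k0 : k = 0%N.
  have : 2 * k%:Z * m%:Z - 2 * k%:Z <= m.+1%:Z.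
    apply: le_trans sum_le; rewrite big_ord_recl addrC lerD //.
    by rewrite -(sum1_ord m) mulr_sumr ler_sum // => i _; rewrite mulr1 rows_ge.
  nia.
split=> //; subst k.
have a_ge0 i : 0 <= inner y (G i).
  by have [->|/rows_ge] := eqVneq i ord0; [have := row0_ge|]; rewrite mulr0 ?oppr0.
have a_le i : inner y (G i) <= m.+1%:Z by rewrite inner_hamming; lia.
(* These non-negative products have a non-positive sum, because the sum of the
   inner products is at most m + 1 and that of their squares is (m + 1)^2. *)
have prod0 i : inner y (G i) * (m.+1%:Z - inner y (G i)) = 0.
  have prod_ge0 j : 0 <= inner y (G j) * (m.+1%:Z - inner y (G j)).
    by rewrite mulr_ge0 ?subr_ge0.
  have sum0 : \sum_j inner y (G j) * (m.+1%:Z - inner y (G j)) = 0.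
    apply/eqP; rewrite eq_le sumr_ge0 // andbT.
    under eq_bigr do rewrite mulrBr -expr2.
    by rewrite sumrB -mulr_suml parseval_rows expr2 subr_le0 ler_pM2r.
  move/eqP: sum0; rewrite psumr_eq0 // => /allP/(_ i (mem_index_enum i)) /=.
  exact: eqP.
have [i ai] : exists i, inner y (G i) != 0.
  apply/existsP; apply: contraT => /existsPn a0.
  have := parseval_rows y; rewrite big1 => [|i _].
    by move/eqP; rewrite eq_sym sqrf_eq0.
  by have := a0 i; rewrite negbK => /eqP->.
exists i; apply: hamming_eq0.
have /eqP := prod0 i; rewrite mulf_eq0 (negbTE ai) /= inner_hamming; lia.
Qed.

End Normalized.

(** * The cross-polytope of rows *)

(** A point that could be added to the facet of the rows themselves would satisfy
the hypotheses of [positive_orthant_row], with [k] the distance between the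
tails: being at distance at most r from a padded row is a lower bound on an inner
product, and the weight condition bounds the inner product with the constant
row. *)
Lemma normalized_hadamard_homology m q r l (G : 'I_m.+2 -> cube m.+2) :
    normalized_hadamard G -> m.+2 = (2 * r)%N -> (4 < m.+2)%N ->
    (r <= l)%N -> (l + r <= m.+2 + q)%N ->
  exists h : homology (vietoris_rips (@layer_dist (m.+2 + q) l) r) m, h != 0.
Proof.
move=> hG mr m4 rl lq; have [G0 Gc rows _] := hG.
have [c wc] : exists c : cube q, weight c = (l - r)%N.
  by apply: exists_weight; lia.
pose row (i : 'I_m.+1) b :=
  if b then G (lift ord0 i) else negate (G (lift ord0 i)).
have row_col0 i b : row i b ord0 = b by case: b; rewrite /row ?ffunE Gc.
have row_weight i b : weight (row i b) = r.
  have : inner (row i b) (G ord0) = 0.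
    by case: b; rewrite /row innerC ?inner_negate rows ?oppr0.
  by rewrite inner_ones //; lia.
have row_orth i j b b' : i != j -> hamming (row i b) (row j b') = r.
  move=> ij; have : inner (row i b) (row j b') = 0.
    have Gij : inner (G (lift ord0 i)) (G (lift ord0 j)) = 0.
      by rewrite rows (inj_eq lift_inj) (negbTE ij).
    by case: b; case: b'; rewrite /row ?inner_negate 1?innerC ?inner_negate
      1?innerC Gij ?oppr0.
  by rewrite inner_hamming; lia.
have row_layer i b : weight (concat (row i b) c) == l.
  by rewrite weight_concat row_weight wc subnKC.
pose p i b : layer (m.+2 + q) l := exist _ (concat (row i b) c) (row_layer i b).
have p_dist i j b b' :
    layer_dist (p i b) (p j b') = hamming (row i b) (row j b').
  by rewrite /layer_dist /= hamming_concat hamming_refl addn0.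
have p_inj i j b b' : p i b = p j b' -> i = j /\ b = b'.
  move=> pp; have : hamming (row i b) (row j b') = 0%N.
    by rewrite -p_dist pp p_dist hamming_refl.
  have [->|/row_orth->] := eqVneq i j; last by lia.
  by move/hamming_eq0 => E; rewrite -(row_col0 j b) E row_col0.
(* The index true is given to the rows starting with 1, so that the facet whose
   maximality is needed is the one made of them. *)
apply: (cross_polytope_homology p_inj) => [|e|v vF]; first exact: card_ord.
  rewrite inE; apply/andP; split.
    by apply/set0Pn; exists (p ord0 (e ord0)); apply: imset_f.
  apply/forall_inP => _ /imsetP[i _ ->]; apply/forall_inP => _ /imsetP[j _ ->].
  rewrite p_dist; have [->|/row_orth-> //] := eqVneq i j.
  by rewrite hamming_refl.
apply/negP; rewrite inE => /andP[_ /forall_inP/(_ v (setU11 _ _))].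
move/forall_inP => v_near.
have /eqP v_weight := valP v.
have [y [z vE]] := concat_surj (val v).
rewrite vE weight_concat in v_weight.
have v_row i : (hamming y (row i true) + hamming z c <= r)%N.
  rewrite -hamming_concat -vE; apply: (v_near (p i true)).
  by apply: setU1r; apply: imset_f.
have wz := weight_hamming z c.
have [zc [i yG]] : hamming z c = 0%N /\ exists i, y = G i.
  apply: (positive_orthant_row hG) => // [i i0|].
    have [j ->|iE] := unliftP ord0 i; last by rewrite iE eqxx in i0.
    by have := v_row j; rewrite inner_hamming /row; lia.
  by rewrite inner_ones //; lia.
have zcE := hamming_eq0 zc.
(* The constant row has weight 2r, whereas [y] has weight r. *)
have [j iE|i0] := unliftP ord0 i; last first.
  have : inner (G ord0) (G ord0) = m.+2%:Z by rewrite rows.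
  by rewrite inner_ones // -i0 -yG; move: v_weight; rewrite zcE wc; lia.
case/negP: vF; apply/imsetP; exists j => //; apply: val_inj.
by rewrite vE zcE yG iE.
Qed.

Theorem theorem10 (r : nat) (hr : (4 <= r)%N)
    (hH : exists H : 'M[int]_(2 * r), hadamard H)
    (n l : nat) (hl : (r <= l)%N) (hn : (l + r <= n)%N) :
  exists h : homology (vietoris_rips (@layer_dist n l) r) (2 * r - 2), h != 0.
Proof.
have mr : (2 * r = (2 * r - 2).+2)%N by lia.
have nE : n = ((2 * r - 2).+2 + (n - 2 * r))%N by lia.
move: (2 * r - 2)%N (n - 2 * r)%N mr nE => m q mr nE.
rewrite mr in hH; have [H /hadamard_normalize[G hG]] := hH.
subst n; apply: (normalized_hadamard_homology hG) => //; lia.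
Qed.
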